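(* For all integers $n\ge 1$ and $k\ge 0$ with $k<n-2$, $NM_{n,\mu}(q)|_{q^k}=a(k)$, where $a(k)$ is the number of integer partitions of $k$.
   Context: $\mathcal{C}_n$ is the set of $n$-cycles in the symmetric group $S_n$. An $n$-cycle is written $C=(c_0,c_1,\dots,c_{n-1})$ with $c_0=1$, viewed as a cyclic arrangement of $\{1,\dots,n\}$. We say $c_s$ is cyclically between $c_i$ and $c_j$ if $i<s<j$, or $j<i<s$, or $s<j<i$. A pair $\langle a,b\rangle$ with $1\le a<b\le n$ is a non-$\mu$-match of $C$ if there exists an integer $x$ with $a<x<b$ that is cyclically between $a$ and $b$ in $C$. $NM_\mu(C)$ is the number of non-$\mu$-matches of $C$, and $NM_{n,\mu}(q)=\sum_{C\in\mathcal{C}_n}q^{NM_\mu(C)}$. $f(q)|_{q^k}$ means the coefficient of $q^k$ in $f(q)$. The number of partitions of $0$ is $1$. *)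

(* Defs.v *)
From mathcomp Require Import all_boot all_order all_fingroup all_algebra.

Set Implicit Arguments.
Unset Strict Implicit.
Unset Printing Implicit Defensive.

Import GRing.Theory.
Local Open Scope ring_scope.

(* The labels {1, ..., n} are represented by 'I_n, i.e. shifted down by one, so
   that the label 1 is the ordinal of value 0.  The notions below only depend on
   the relative order of the labels. *)

Definition ncycles (n : nat) : {set 'S_n} :=
  [set C : 'S_n | [exists x, #|porbit C x| == n]].

(* The entry c_i of C = (c_0, c_1, ..., c_(n-1)): C maps c_i to c_(i+1), and
   c_0 is the smallest label. *)
Definition cycle_entry (n : nat) (n_gt0 : (0 < n)%N) (C : 'S_n) (i : nat) : 'I_n :=
  (C ^+ i)%g (Ordinal n_gt0).

Definition cyc_between (n : nat) (n_gt0 : (0 < n)%N) (C : 'S_n)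
    (a b x : 'I_n) : bool :=
  [exists i : 'I_n, exists s : 'I_n, exists j : 'I_n,
    [&& cycle_entry n_gt0 C i == a,
        cycle_entry n_gt0 C s == x,
        cycle_entry n_gt0 C j == b &
        [|| (i < s < j)%N, (j < i < s)%N | (s < j < i)%N]]].

Definition nonmu_match (n : nat) (n_gt0 : (0 < n)%N) (C : 'S_n)
    (a b : 'I_n) : bool :=
  (a < b)%N && [exists x : 'I_n, (a < x < b)%N && cyc_between n_gt0 C a b x].

Definition NMmu (n : nat) (n_gt0 : (0 < n)%N) (C : 'S_n) : nat :=
  #|[set ab : 'I_n * 'I_n | nonmu_match n_gt0 C ab.1 ab.2]|.

Definition NMmu_poly (n : nat) (n_gt0 : (0 < n)%N) : {poly int} :=
  \sum_(C in ncycles n) 'X^(NMmu n_gt0 C).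

Definition is_partition (k : nat) (s : seq nat) : bool :=
  [&& sorted geq s, 0%N \notin s & sumn s == k].

(* A partition of k has at most k parts, each at most k, so all of them occur in
   the finite type of sequences of length at most k over {0, ..., k}. *)
Definition num_partitions (k : nat) : nat :=
  #|[set p : k.-bseq 'I_k.+1 | is_partition k (map val p)]|.

(* Main.v *)
(** Let [pos] be the position of each label in the cycle.  Whether a pair
    <a, b> is a non-match only depends on the labels between a and b, so one
    can reason by induction on intervals of labels.

    Either the non-matches in an interval [lo, hi] are closed under enlarging
    the pair (they form a Young diagram with corner <lo, hi>), or there are at
    least hi - lo - 1 of them.  Indeed, suppose the property holds for both
    [lo, hi-1] and [lo+1, hi] but fails for [lo, hi]: then <lo, hi> is a match,
    and if some x strictly between lo and hi made both <lo, x> and <x, hi>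
    matches, every pair would be a match; hence each x yields a non-match.
    So a cycle with k < n - 2 non-matches has a Young diagram of size k.

    Conversely a Young diagram with columns c(b) = #{a : <a, b> in it}, where
    c(b) < b, is the diagram of exactly one cycle, obtained by inserting the
    labels 0, 1, 2, ... in order, b immediately after c(b). *)
Require Import Defs.
From mathcomp Require Import all_boot all_order all_fingroup all_algebra.
From mathcomp Require Import zify.

Set Implicit Arguments.
Unset Strict Implicit.
Unset Printing Implicit Defensive.

(** * Cyclic order and non-matches *)

Definition cyc (pos : nat -> nat) (a x b : nat) : bool :=
  [|| pos a < pos x < pos b, pos b < pos a < pos x | pos x < pos b < pos a].

(** Labels are plain naturals, so that intervals of labels are handled by arithmetic. The bounded
    search keeps the predicate boolean, and a witness forces [a < b]. *)
Definition nonmatch (pos : nat -> nat) (a b : nat) : bool :=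
  has (fun x => (a < x) && cyc pos a x b) (iota 0 b).

Lemma nonmatchP pos a b :
  reflect (exists2 x, a < x < b & cyc pos a x b) (nonmatch pos a b).
Proof.
apply: (iffP hasP) => [[x] | [x /andP[ax xb] cx]].
  by rewrite mem_iota /= => xb /andP[ax cx]; exists x; rewrite ?ax.
by exists x; rewrite ?mem_iota ?ax.
Qed.

Lemma cyc_rot pos a x b : cyc pos a x b = cyc pos x b a.
Proof. by rewrite /cyc [RHS]orbC orbA. Qed.

Lemma cyc_asym pos a x b : cyc pos a x b -> ~~ cyc pos a b x.
Proof. by rewrite /cyc; lia. Qed.

(** This law and the next one both read the cyclic order [a, x, b, y] and drop one label. *)
Lemma cyc_trans pos a x b y : cyc pos a x b -> cyc pos a b y -> cyc pos x b y.
Proof. by rewrite /cyc; lia. Qed.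

Lemma cyc_trans_l pos a x b y : cyc pos a x b -> cyc pos a b y -> cyc pos a x y.
Proof. by rewrite /cyc; lia. Qed.

Lemma nonmatch_gap pos a b : nonmatch pos a b -> a.+1 < b.
Proof. case/nonmatchP=> x; lia. Qed.

Definition young (pos : nat -> nat) (lo hi : nat) : Prop :=
  forall a' a b b', lo <= a' <= a -> b <= b' <= hi ->
    nonmatch pos a b -> nonmatch pos a' b'.

(** * Young diagram or many non-matches *)

Section Dichotomy.

Variables (pos : nat -> nat) (n : nat).
Hypothesis pos_inj : {in gtn n &, injective pos}.

Let neq x y : x < n -> y < n -> x != y -> pos x != pos y.
Proof. by move=> xn yn; apply: contra_neq; apply: pos_inj. Qed.

(** The positive form of a match: positions being distinct, the labels between [a] and [b] lie on
    the arc from [b] back to [a]. *)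
Let matchW a b x : b < n -> ~~ nonmatch pos a b -> a < x < b -> cyc pos a b x.
Proof.
move=> bn nm /andP[ax xb]; have: ~~ cyc pos a x b.
  by apply: contra nm => cx; apply/nonmatchP; exists x; rewrite ?ax.
have := @neq a x ltac:(lia) ltac:(lia) ltac:(lia).
have := @neq a b ltac:(lia) ltac:(lia) ltac:(lia).
have := @neq x b ltac:(lia) ltac:(lia) ltac:(lia).
rewrite /cyc; lia.
Qed.

(** Read forward from [hi], the matches with [hi] force the labels of the interval into decreasing
    order, and in a decreasing cyclic arrangement every pair is a match. *)
Lemma match_top lo hi : hi < n ->
  (forall a, lo <= a < hi -> ~~ nonmatch pos a hi) ->
  forall a b, lo <= a -> b <= hi -> ~~ nonmatch pos a b.
Proof.
move=> hin top a b loa bhi; apply/nonmatchP=> -[x /andP[ax xb] cx].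
have [eqb|ltb] := eqVneq b hi.
  have /nonmatchP[] : ~~ nonmatch pos a b by rewrite eqb top //; lia.
  by exists x; rewrite ?ax.
have c1 := matchW hin (top a ltac:(lia)) (ltac:(lia) : is_true (a < x < hi)).
have c2 := matchW hin (top x ltac:(lia)) (ltac:(lia) : is_true (x < b < hi)).
by have := cyc_asym (cyc_trans c1 cx); rewrite -cyc_rot c2.
Qed.

(** The mirror image: read forward from [lo], the other labels decrease. *)
Lemma match_bottom lo hi : hi < n ->
  (forall b, lo < b <= hi -> ~~ nonmatch pos lo b) ->
  forall a b, lo <= a -> b <= hi -> ~~ nonmatch pos a b.
Proof.
move=> hin bot a b loa bhi; apply/nonmatchP=> -[x /andP[ax xb] cx].
have [eqa|lta] := eqVneq a lo.
  have /nonmatchP[] : ~~ nonmatch pos a b by rewrite eqa bot //; lia.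
  by exists x; rewrite ?ax.
have c1 := matchW (ltac:(lia) : is_true (b < n)) (bot b ltac:(lia)) (ltac:(lia) : is_true (lo < x < b)).
have c2 := matchW (ltac:(lia) : is_true (x < n)) (bot x ltac:(lia)) (ltac:(lia) : is_true (lo < a < x)).
by have := cyc_asym (cyc_trans c1 c2); rewrite cyc_rot cx.
Qed.

(** By the two diagrams, the matches at [x] spread to [<lo, z>] for [lo < z <= x] and to [<z, hi>]
    for [x <= z < hi]. A witness [z] of a non-match [<lo, y>] with [x < y < hi] would contradict the
    match [<z, hi>] if [x <= z], and [<x, hi>] otherwise. *)
Lemma match_middle lo hi x : hi < n -> lo < x < hi ->
  young pos lo hi.-1 -> young pos lo.+1 hi ->
  ~~ nonmatch pos lo hi -> ~~ nonmatch pos lo x -> ~~ nonmatch pos x hi ->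
  forall b, lo < b <= hi -> ~~ nonmatch pos lo b.
Proof.
move=> hin /andP[lox xhi] y1 y2 m1 m2 m3 y /andP[loy yhi].
have low z : lo < z <= x -> ~~ nonmatch pos lo z.
  by move=> ?; apply: contra m2; apply: y1; lia.
have high z : x <= z < hi -> ~~ nonmatch pos z hi.
  by move=> ?; apply: contra m3; apply: y2; lia.
have [yx|xy] := leqP y x; first by apply: low; lia.
have [->//|yhi'] := eqVneq y hi.
apply/nonmatchP=> -[z /andP[loz zy] cz].
have [xz|zx] := leqP x z.
  have c1 := matchW hin m1 (ltac:(lia) : is_true (lo < z < hi)).
  have := matchW hin (high z ltac:(lia)) (ltac:(lia) : is_true (z < y < hi)).
  by rewrite cyc_rot => /cyc_asym; rewrite (cyc_trans c1 cz).
have c1 := matchW hin m1 (ltac:(lia) : is_true (lo < x < hi)).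
have c2 := matchW (ltac:(lia) : is_true (x < n)) m2 (ltac:(lia) : is_true (lo < z < x)).
have := matchW hin m3 (ltac:(lia) : is_true (x < y < hi)).
by rewrite cyc_rot => /cyc_asym; rewrite (cyc_trans c1 (cyc_trans_l c2 cz)).
Qed.

Lemma young_or_many lo hi : lo <= hi < n ->
  young pos lo hi \/
  exists2 l : seq (nat * nat), uniq l /\ hi - lo - 1 <= size l &
    forall a b, (a, b) \in l -> [/\ lo <= a, b <= hi & nonmatch pos a b].
Proof.
have [d] := ubnP (hi - lo); elim: d lo hi => // d IHd lo hi.
move=> ltd /andP[lohi hin].
have no_young : (forall a b, lo <= a -> b <= hi -> ~~ nonmatch pos a b) ->
    young pos lo hi.
  by move=> no a' a b b' ? ? nm; have := no a b; rewrite nm; lia.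
have [small|big] := leqP hi lo.+1.
  by left; apply: no_young => a b ? ?; apply/negP=> /nonmatch_gap; lia.
(* If the shorter interval has many non-matches, a non-match ending at [hi] supplies the missing
   one; without such a pair there is no non-match at all. *)
have [y1|[l [ul sl] lP]] := IHd lo hi.-1 ltac:(lia) ltac:(lia); last first.
  have [/hasP[a]|/hasPn no] := boolP (has (nonmatch pos ^~ hi) (iota lo (hi - lo))).
    rewrite mem_iota => ain nma; right; exists ((a, hi) :: l).
      split; last by rewrite /=; lia.
      by rewrite /= ul andbT; apply/negP => /lP[]; lia.
    by move=> a' b'; rewrite inE => /orP[/eqP[-> ->]|/lP[? ? ?]]; split=> //; lia.
  left; apply: no_young; apply: match_top => // a ain.
  by apply: no; rewrite mem_iota; lia.
have [y2|[l [ul sl] lP]] := IHd lo.+1 hi ltac:(lia) ltac:(lia); last first.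
  have [/hasP[b]|/hasPn no] := boolP (has (nonmatch pos lo) (iota lo.+1 (hi - lo))).
    rewrite mem_iota => bin nmb; right; exists ((lo, b) :: l).
      split; last by rewrite /=; lia.
      by rewrite /= ul andbT; apply/negP => /lP[]; lia.
    by move=> a' b'; rewrite inE => /orP[/eqP[-> ->]|/lP[? ? ?]]; split=> //; lia.
  left; apply: no_young; apply: match_bottom => // b bin.
  by apply: no; rewrite mem_iota; lia.
have [nm|m] := boolP (nonmatch pos lo hi).
  left => a' a b b' ha hb nmab.
  (* An enlarged pair other than [<lo, hi>] lies in one of the shorter intervals, together with the
     pair it enlarges. *)
  have [e1|n1] := eqVneq a' lo; last by apply: y2 nmab; lia.
  have [e2|n2] := eqVneq b' hi; last by apply: y1 nmab; lia.
  by rewrite e1 e2.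
have [/hasP[x]|/hasPn no] :=
  boolP (has (fun x => ~~ nonmatch pos lo x && ~~ nonmatch pos x hi)
             (iota lo.+1 (hi - lo).-1)).
  rewrite mem_iota => xin /andP[m2 m3]; left; apply: no_young.
  by apply: match_bottom => //; apply: (@match_middle _ _ x) => //; lia.
(* Each of the [hi - lo - 1] inner labels selects a non-match; the forms [(lo, x)] and [(x, hi)]
   never coincide. *)
right; exists [seq if nonmatch pos lo x then (lo, x) else (x, hi)
              | x <- iota lo.+1 (hi - lo).-1].
  split; last by rewrite size_map size_iota; lia.
  rewrite map_inj_in_uniq ?iota_uniq // => x y; rewrite !mem_iota.
  by case: ifP; case: ifP => _ _ hx hy [] //; lia.
move=> a b /mapP[x xin]; move: (no x xin); move: xin; rewrite mem_iota.
by case: ifP => [nmx|_] /= hx; rewrite ?negbK => nmx' [-> ->]; split=> //; lia.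
Qed.

End Dichotomy.

(** * Insertion codes *)

(* b sits right after c b once the labels above b are erased; with the label 0 in
   position 0 no wrap-around has to be considered. *)
Definition insertion (pos c : nat -> nat) (n : nat) : Prop :=
  forall b x, x < b < n -> (pos x < pos b) = (pos x <= pos (c b)).

Section Insertion.

Variables (pos c : nat -> nat) (n : nat).
Hypothesis pos_inj : {in gtn n &, injective pos}.
Hypothesis c_lt : forall b, 0 < b < n -> c b < b.

Let neq x y : x < n -> y < n -> x != y -> pos x != pos y.
Proof. by move=> xn yn; apply: contra_neq; apply: pos_inj. Qed.

(** Among the labels up to [b], [c b] directly precedes [b], so it witnesses the non-match for any
    smaller [a]. For [a > c b], a witness [x] would put [a] between [c b] and [x]; by induction
    [c b < c x], against monotonicity. *)
Lemma insertion_nonmatch :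
    insertion pos c n -> (forall b b', 0 < b <= b' -> b' < n -> c b <= c b') ->
  forall a b, a < b < n -> nonmatch pos a b = (a < c b).
Proof.
move=> ins c_mono a b; elim/ltn_ind: b a => b IHb a abn.
have cb := c_lt (ltac:(lia) : is_true (0 < b < n)).
have adj x : x < b -> x != c b -> cyc pos (c b) b x.
  move=> xb xc; rewrite /cyc.
  have := ins b x ltac:(lia); have := ins b (c b) ltac:(lia).
  have := @neq x (c b) ltac:(lia) ltac:(lia) xc.
  have := @neq x b ltac:(lia) ltac:(lia) ltac:(lia).
  lia.
have [ac|ca] := ltnP a (c b).
  apply/nonmatchP; exists (c b); first by rewrite ac.
  by rewrite cyc_rot adj //; lia.
apply/negP=> /nonmatchP[x /andP[ax xb] cx].
have cbx := adj x xb ltac:(lia).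
have [eqa|na] := eqVneq a (c b).
  by move: (cyc_asym cbx); rewrite -eqa cx.
have cba := adj a ltac:(lia) na.
suff: nonmatch pos (c b) x.
  rewrite IHb //; last by lia.
  have := c_mono x b ltac:(lia) ltac:(lia); lia.
apply/nonmatchP; exists a; first by lia.
rewrite cyc_rot; apply: (@cyc_trans _ b); first by rewrite cyc_rot.
by rewrite -cyc_rot.
Qed.

(** No [z < b] lies between [c b] and [b], by descending induction on [z]: if some [z < c b] did, so
    would the witness [y > z] of the non-match [<z, b>]. *)
Lemma nonmatch_insertion : pos 0 = 0 ->
  (forall a b, a < b < n -> nonmatch pos a b = (a < c b)) -> insertion pos c n.
Proof.
move=> pos0 nmE b x xbn.
have cb := c_lt (ltac:(lia) : is_true (0 < b < n)).
have adj z : z < b -> ~~ cyc pos (c b) z b.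
  have [d] := ubnP (b - z); elim: d z => // d IHd z ltd zb.
  have [cz|zc] := ltnP (c b) z.
    apply/negP=> cyz; have /nonmatchP[] : ~~ nonmatch pos (c b) b.
      by rewrite nmE ?ltnn //; lia.
    by exists z; rewrite ?cz.
  have [->|nz] := eqVneq z (c b); first by rewrite /cyc; lia.
  have /nonmatchP[y /andP[zy yb] cy] : nonmatch pos z b by rewrite nmE; lia.
  have := IHd y ltac:(lia) yb; apply: contra => cz.
  by rewrite -cyc_rot; apply: (@cyc_trans_l _ b _ z); rewrite cyc_rot.
(* As [pos 0 = 0], [a0] excludes [pos b < pos (c b)], which turns cyclic adjacency into a linear
   comparison. *)
have a0 := adj 0 ltac:(lia); have ax := adj x ltac:(lia).
have e0 := @neq 0 b ltac:(lia) ltac:(lia) ltac:(lia).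
have e1 := @neq x b ltac:(lia) ltac:(lia) ltac:(lia).
have e2 := @neq (c b) b ltac:(lia) ltac:(lia) ltac:(lia).
by move: a0 ax e0 e1 e2; rewrite /cyc pos0; lia.
Qed.

End Insertion.

(** Comparing [x] with a larger [y] reduces to comparing [x] with [c y < y], so the code settles
    every comparison. *)
Lemma insertion_order pos pos' c n :
    {in gtn n &, injective pos} -> {in gtn n &, injective pos'} ->
    (forall b, 0 < b < n -> c b < b) ->
    insertion pos c n -> insertion pos' c n ->
  forall x y, x < n -> y < n -> (pos x < pos y) = (pos' x < pos' y).
Proof.
move=> inj inj' c_lt ins ins'.
have key m : forall x y, x < n -> y < n -> x < y < m ->
    (pos x < pos y) = (pos' x < pos' y) /\ (pos y < pos x) = (pos' y < pos' x).
  elim: m => [|m IHm] x y xn yn /andP[xy ym]; first by lia.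
  have cy := c_lt y ltac:(lia).
  have e : (pos x < pos y) = (pos' x < pos' y).
    rewrite (ins y x ltac:(lia)) (ins' y x ltac:(lia)) (leqNgt (pos x)) (leqNgt (pos' x)); congr (~~ _).
    have [->|] := eqVneq (c y) x; first by rewrite !ltnn.
    rewrite neq_ltn => /orP[cx|cx].
    - by have [] := IHm (c y) x ltac:(lia) xn ltac:(lia).
    - by have [] := IHm x (c y) xn ltac:(lia) ltac:(lia).
  split=> //; rewrite ltnNge leq_eqVlt e [RHS]ltnNge [in RHS]leq_eqVlt; congr (~~ (_ || _)).
  by apply/eqP/eqP=> [/inj|/inj'] ->.
move=> x y xn yn; have [->|] := eqVneq x y; first by rewrite !ltnn.
rewrite neq_ltn => /orP[xy|xy].
- by have [] := key y.+1 x y xn yn ltac:(lia).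
- by have [] := key x.+1 y x yn xn ltac:(lia).
Qed.

(** * Arrangements built by insertion *)

(** If [x] is absent, [m] goes to the end; so the label 0 enters the empty list whatever [c 0]
    is. *)
Definition insert_after (m x : nat) (s : seq nat) : seq nat :=
  take (index x s).+1 s ++ m :: drop (index x s).+1 s.

Fixpoint arrangement (c : nat -> nat) (m : nat) : seq nat :=
  if m is m'.+1 then insert_after m' (c m') (arrangement c m') else [::].

Lemma perm_insert_after m x s : perm_eq (insert_after m x s) (m :: s).
Proof. by rewrite perm_catC /= perm_cons perm_catC cat_take_drop. Qed.

Lemma index_insert_after (m x y : nat) (s : seq nat) : m \notin s -> y \in s -> x \in s ->
  index y (insert_after m x s) = bump (index x s).+1 (index y s) /\
  index m (insert_after m x s) = (index x s).+1.
Proof.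
move=> ms ys xs; rewrite /insert_after.
have st : size (take (index x s).+1 s) = (index x s).+1.
  by rewrite size_takel // index_mem.
have ym : m != y by apply: contraNneq ms => ->.
split; last first.
  rewrite index_cat ifN /= ?eqxx ?addn0 //.
  by apply: contra ms; apply: mem_take.
have -> : index y s = index y (take (index x s).+1 s ++ drop (index x s).+1 s).
  by rewrite cat_take_drop.
rewrite !index_cat st /= (negPf ym); case: ifP => [yt|_]; last by rewrite /bump; lia.
have: index y (take (index x s).+1 s) < (index x s).+1 by rewrite -{2}st index_mem.
by rewrite ltnNge /bump => /negPf ->.
Qed.

Lemma perm_arrangement c m : perm_eq (arrangement c m) (iota 0 m).
Proof.
elim: m => // m IHm; have -> : iota 0 m.+1 = rcons (iota 0 m) m.
  by rewrite -addn1 iotaD cats1.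
apply: perm_trans (perm_insert_after _ _ _) _.
by rewrite perm_sym perm_rcons perm_cons perm_sym.
Qed.

(** An insertion shifts positions by the strictly increasing [bump], so earlier comparisons persist;
    for the new label the claim is read off its slot. *)
Lemma arrangement_insertion c n : (forall b, 0 < b < n -> c b < b) ->
  insertion (index^~ (arrangement c n)) c n.
Proof.
elim: n => [|n IHn] c_lt b x xbn; first by lia.
have mem y : (y \in arrangement c n) = (y < n).
  by rewrite (perm_mem (perm_arrangement c n)) mem_iota.
have cb := c_lt b ltac:(lia).
have nm : n \notin arrangement c n by rewrite mem ltnn.
have idx z (zs : z \in arrangement c n) y : y < n -> _ :=
  fun yn => index_insert_after nm (etrans (mem y) yn) zs.
have [bn|nb] := ltnP b n.
  have cn : c n \in arrangement c n by rewrite mem; apply: c_lt; lia.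
  have IH := IHn ltac:(move=> *; apply: c_lt; lia) b x ltac:(lia).
  have [ex _] := idx _ cn x ltac:(lia).
  have [eb _] := idx _ cn b ltac:(lia).
  have [ec _] := idx _ cn (c b) ltac:(lia).
  by rewrite /= ex eb ec; move: IH; rewrite /bump; lia.
have -> : b = n by lia.
have cn : c n \in arrangement c n by rewrite mem; apply: c_lt; lia.
have [ex en] := idx _ cn x ltac:(lia).
have [ec _] := idx _ cn (c n) ltac:(by rewrite -mem).
by rewrite /= ex en ec /bump; lia.
Qed.

(** Later insertions go behind an existing label, so the head stays 0; on the empty list 0 is the
    default of [nth]. *)
Lemma nth0_arrangement c n : nth 0 (arrangement c n) 0 = 0.
Proof.
elim: n => // n; rewrite /= /insert_after.
by have := perm_size (perm_arrangement c n); case: arrangement => //=; case: n.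
Qed.

(** * Cycles as lists of entries *)

Section Entries.

Variables (n : nat) (n_gt0 : 0 < n).
Implicit Type C : 'S_n.
Let z := Ordinal n_gt0.

Definition entries C : seq nat := map val (traject C z n).

Definition pos C (a : nat) : nat := index a (entries C).

(** A full orbit is the orbit of every label, in particular of the label 0, where [entries]
    starts. *)
Lemma ncycleP C : reflect (#|porbit C z| = n) (C \in ncycles n).
Proof.
rewrite inE; apply: (iffP existsP) => [[x /eqP px]|pz]; last by exists z; apply/eqP.
have px1 : porbit C x = [set: 'I_n].
  by apply/eqP; rewrite eqEcard subsetT cardsT card_ord px leqnn.
have /eqP-> : porbit C z == porbit C x by rewrite eq_porbit_mem px1.
exact: px.
Qed.

Lemma size_entries C : size (entries C) = n.
Proof. by rewrite size_map size_traject. Qed.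

Lemma uniq_entries C : C \in ncycles n -> uniq (entries C).
Proof.
move=> /ncycleP pz; rewrite map_inj_uniq; last exact: val_inj.
by rewrite -[X in traject _ _ X]pz uniq_traject_porbit.
Qed.

Lemma mem_entries C a : C \in ncycles n -> (a \in entries C) = (a < n).
Proof.
move=> Cn; have [//||_ ->] := uniq_min_size (uniq_entries Cn) (s2 := iota 0 n).
- by move=> _ /mapP[x _ ->]; rewrite mem_iota /=.
- by rewrite size_entries size_iota.
by rewrite mem_iota.
Qed.

Lemma nth_entries C i : i < n -> nth 0 (entries C) i = cycle_entry n_gt0 C i.
Proof.
move=> lti; rewrite (nth_map z) ?size_traject // /cycle_entry permX.
by rewrite nth_traject.
Qed.

Lemma pos_inj C : C \in ncycles n -> {in gtn n &, injective (pos C)}.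
Proof.
move=> Cn x y; rewrite !inE -!(mem_entries _ Cn) => xC yC e.
by rewrite -(nth_index 0 xC) -/(pos C x) e nth_index.
Qed.

Lemma pos0 C : pos C 0 = 0.
Proof.
have := size_entries C; have := nth_entries C n_gt0.
by rewrite /cycle_entry expg0 perm1 /pos; case: (entries C) => [|x s /= ->].
Qed.

Lemma cyc_betweenE C (a b x : 'I_n) : C \in ncycles n ->
  cyc_between n_gt0 C a b x = cyc (pos C) a x b.
Proof.
move=> Cn; have posE i : i < n -> pos C (cycle_entry n_gt0 C i) = i.
  by move=> ?; rewrite -nth_entries // /pos index_uniq ?size_entries ?uniq_entries.
have posK (y : 'I_n) : exists i : 'I_n, pos C y = i /\ cycle_entry n_gt0 C i == y.
  have yC : nat_of_ord y \in entries C by rewrite mem_entries.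
  have lti : pos C y < n by rewrite /pos -[X in _ < X](size_entries C) index_mem.
  by exists (Ordinal lti); split=> //; apply/eqP/val_inj; rewrite /= -nth_entries ?nth_index.
apply/existsP/idP => [[i /existsP[s /existsP[j]]]|].
  by case/and4P=> /eqP<- /eqP<- /eqP<-; rewrite /cyc !posE.
have [[i [ei Ei]] [j [ej Ej]]] := (posK a, posK b); have [s [es Es]] := posK x.
move=> c; exists i; apply/existsP; exists s; apply/existsP; exists j.
by rewrite Ei Ej Es -ei -ej -es.
Qed.

Lemma nonmu_matchE C (a b : 'I_n) : C \in ncycles n ->
  nonmu_match n_gt0 C a b = nonmatch (pos C) a b.
Proof.
move=> Cn; apply/andP/nonmatchP=> [[_ /existsP[x /andP[axb]]]|[x axb]].
  by rewrite cyc_betweenE //; exists x.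
have xn : x < n by have := ltn_ord b; lia.
split; first by lia.
by apply/existsP; exists (Ordinal xn); rewrite cyc_betweenE //= axb.
Qed.

Lemma NMmuE C : C \in ncycles n ->
  NMmu n_gt0 C = \sum_(b < n) \sum_(a < n) nonmatch (pos C) a b.
Proof.
move=> Cn; rewrite exchange_big pair_bigA /NMmu -sum1_card /=.
rewrite big_mkcond; apply: eq_bigr => ab _.
by rewrite inE nonmu_matchE //; case: nonmatch.
Qed.

Lemma fcycle_traject C : C \in ncycles n -> fcycle C (traject C z n).
Proof.
move=> /ncycleP pz; have := iter_porbit C z; rewrite pz.
have -> : iter n C z = iter n.-1 C (C z) by rewrite -iterSr prednK.
move=> iz.
have -> : traject C z n = z :: traject C (C z) n.-1 by rewrite -trajectS prednK.
rewrite /= -[X in rcons _ X]iz -trajectSr.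
exact: fpath_traject.
Qed.

Lemma entries_inj : {in ncycles n &, injective entries}.
Proof.
move=> C C' Cn Cn' /(inj_map val_inj) eqt; apply/permP=> x.
have mem : x \in traject C z n.
  have := mem_entries (val x) Cn; rewrite (mem_map val_inj) => ->.
  exact: ltn_ord.
have /eqP -> := next_cycle (fcycle_traject Cn) mem.
rewrite eqt in mem *.
by have /eqP -> := next_cycle (fcycle_traject Cn') mem.
Qed.

Lemma entries_surj s : perm_eq s (iota 0 n) -> nth 0 s 0 = 0 ->
  exists2 C, C \in ncycles n & entries C = s.
Proof.
move=> ps s0; pose t := map (insubd z) s.
have szs : size s = n by rewrite (perm_size ps) size_iota.
have valt : map val t = s.
  rewrite -map_comp map_id_in // => i; rewrite (perm_mem ps) mem_iota => /andP[_ lti] /=.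
  by rewrite val_insubd lti.
have ut : uniq t.
  by rewrite -(map_inj_uniq val_inj) valt (perm_uniq ps) iota_uniq.
have memt x : x \in t.
  by rewrite -(mem_map val_inj) valt (perm_mem ps) mem_iota /=.
(* The cycle sends each label to its successor in [t]; [prev] inverts this, whence injectivity. *)
pose C := perm (can_inj (prev_next ut)).
have Ct : traject C z n = t.
  have: fcycle C t by apply: cycle_from_next => // x _; rewrite /= permE.
  have: size t = n by rewrite size_map.
  have : val (head z t) = 0.
    by move: s0; rewrite -valt nth0; case: (t).
  case: (t) => [|y t'] /= y0; first by move=> e; have := n_gt0; rewrite -[X in _ < X]e.
  have -> : y = z by apply: val_inj.
  move=> szt /fpathE; rewrite size_rcons trajectSr => /rcons_inj[e _].
  have -> : traject C z n = traject C z (size t').+1 by rewrite szt.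
  by rewrite trajectS -e.
exists C; last by rewrite /entries Ct.
apply/ncycleP; rewrite -[RHS]card_ord -cardsT; congr #|pred_of_set _|.
apply/setP=> x; rewrite inE; have := memt x; rewrite -Ct => /trajectP[i _ ->].
by rewrite -permX mem_porbit.
Qed.

Lemma sorted_pos C : C \in ncycles n -> sorted (relpre (pos C) ltn) (entries C).
Proof.
move=> Cn; rewrite -sorted_map.
suff -> : map (pos C) (entries C) = iota 0 n by apply: iota_ltn_sorted.
apply: (@eq_from_nth _ 0); rewrite size_map size_entries ?size_iota // => i lti.
rewrite (nth_map 0) ?size_entries // nth_iota // /pos index_uniq ?size_entries //.
exact: uniq_entries.
Qed.

(** [entries] lists the labels sorted by [pos], and a strictly sorted list is determined by its
    elements and the order. *)
Lemma pos_order_inj C C' : C \in ncycles n -> C' \in ncycles n ->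
  (forall x y, x < n -> y < n -> (pos C x < pos C y) = (pos C' x < pos C' y)) ->
  C = C'.
Proof.
move=> Cn Cn' eqo; apply: entries_inj => //.
apply: (@irr_sorted_eq _ (relpre (pos C) ltn)).
- by move=> y x w /=; apply: ltn_trans.
- by move=> x /=; rewrite ltnn.
- exact: sorted_pos.
- have := sorted_pos Cn'; apply: sub_in_sorted (allss _) => x y.
  by rewrite !mem_entries // => xn yn /=; rewrite eqo.
- by move=> x; rewrite !mem_entries.
Qed.

End Entries.

(** * Column heights and partitions *)

(** A downward closed set of naturals is an initial segment, so its size is its threshold. *)
Lemma sum_initial (p : nat -> bool) n :
    (forall a a', a' <= a -> p a -> p a') ->
  forall a, a < n -> p a = (a < \sum_(i < n) p i).
Proof.
move=> pdown.
have bound m : \sum_(i < m) p i <= m.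
  by rewrite -[X in _ <= X]card_ord -sum1_card leq_sum // => i _; case: (p i).
have full m : p m -> \sum_(i < m) p i = m.
  elim: m => [|m IHm] pm; first by rewrite big_ord0.
  have pm' : p m by apply: pdown pm.
  by rewrite big_ord_recr /= IHm // pm' addn1.
elim: n => // n IHn a an; rewrite big_ord_recr /=.
case pn: (p n); first by rewrite full // addn1 an (pdown _ _ _ pn).
rewrite addn0; have [an'|na] := ltnP a n; first exact: IHn.
have -> : a = n by lia.
by rewrite pn ltnNge bound.
Qed.

Lemma sum_ltn c n : c <= n -> \sum_(a < n) (a < c) = c.
Proof.
elim: n => [|n IHn] cn; first by rewrite big_ord0; lia.
rewrite big_ord_recr /=; have [->|nc] := eqVneq c n.+1; last first.
  by rewrite IHn; lia.
under eq_bigr => i _ do rewrite (leq_trans (ltn_ord i)) //.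
by rewrite sum1_card card_ord ltnS leqnn addn1.
Qed.

Lemma sumn_ord s n : size s <= n -> sumn s = \sum_(i < n) nth 0 s i.
Proof.
elim: n s => [|n IHn] [|x s] //= sn; first by rewrite big_ord0.
  by rewrite big1 // => i _; rewrite nth_nil.
by rewrite big_ord_recl /= (IHn s).
Qed.

Lemma sum_rev n (F : nat -> nat) : \sum_(b < n) F (n - b.+1) = \sum_(i < n) F i.
Proof. by rewrite [RHS](reindex_inj rev_ord_inj). Qed.

Lemma seq_of_nonincreasing (f : nat -> nat) n :
    (forall i, f i.+1 <= f i) -> (forall i, n <= i -> f i = 0) ->
  exists s, [/\ sorted geq s, 0 \notin s, size s <= n & nth 0 s =1 f].
Proof.
elim: n f => [|n IHn] f fmono f0.
  by exists [::]; split=> // i; rewrite nth_nil f0.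
have [f00|fn0] := posnP (f 0).
  exists [::]; split=> // i; rewrite nth_nil.
  by elim: i => // i IHi; have := fmono i; rewrite -IHi; lia.
have [i|i ni|s [ss s0 sn sf]] := IHn (fun i => f i.+1); first exact: fmono.
  by apply: f0.
exists (f 0 :: s); split=> [|||[|i]] //=.
- by case: s ss sf {s0 sn} => //= y s -> /(_ 0) /= ->; rewrite andbT; apply: fmono.
- by rewrite inE negb_or s0 andbT eq_sym -lt0n.
Qed.

(** The [i] earlier parts are positive, so they take up at least [i] of the sum. *)
Lemma nth_partition k s i : is_partition k s -> i < size s -> nth 0 s i + i <= k.
Proof.
case/and3P=> _ s0 /eqP<-; elim: s i s0 => //= x s IHs i.
rewrite inE negb_or => /andP[x0 s0]; case: i => [|i] /= si; first by lia.
have := IHs i s0 si; lia.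
Qed.

Lemma size_partition k s : is_partition k s -> size s <= k.
Proof.
move=> ps; have [->//|s0] := posnP (size s).
have := nth_partition ps (ltac:(lia) : (size s).-1 < size s).
have /and3P[_ /negP nz _] := ps.
have : nth 0 s (size s).-1 != 0.
  apply/eqP => e; apply: nz; have := mem_nth 0 (ltac:(lia) : (size s).-1 < size s).
  by rewrite e.
lia.
Qed.

(** There are at most [k] parts, and the length is read off the nonzero values of [nth]. *)
Lemma partition_eq k s s' : is_partition k s -> is_partition k s' ->
  (forall i, i < k -> nth 0 s i = nth 0 s' i) -> s = s'.
Proof.
move=> ps ps' e.
have nz t i : is_partition k t -> (i < size t) = (nth 0 t i != 0).
  case/and3P=> _ t0 _; have [it|ti] := ltnP i (size t).
    by apply/esym; apply: contraNneq t0 => <-; apply: mem_nth.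
  by rewrite nth_default.
have ee i : nth 0 s i = nth 0 s' i.
  have [/e//|ki] := ltnP i k.
  by rewrite !nth_default // (leq_trans (size_partition _) ki).
apply: (@eq_from_nth _ 0) => //.
have h1 := nz _ (size s') ps; have h2 := nz _ (size s) ps'.
have h3 := nz _ (size s') ps'; have h4 := nz _ (size s) ps.
move: h1 h2 h3 h4; rewrite !ee; lia.
Qed.

Lemma partition_bseq k s : is_partition k s ->
  exists p : k.-bseq 'I_k.+1, map val p = s.
Proof.
move=> ps; have sk : size [seq inord i : 'I_k.+1 | i <- s] <= k.
  by rewrite size_map size_partition.
exists (Bseq sk); rewrite /= -map_comp map_id_in // => _ /(nthP 0)[i si <-] /=.
by rewrite inordK //; have := nth_partition ps si; lia.
Qed.

(** * Shapes of cycles *)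

(* Part i of the partition is the column of b = n - 1 - i, which is
   {a | <a, b> is a non-match}. *)
Definition has_shape (pos : nat -> nat) (n : nat) (s : seq nat) : Prop :=
  forall a b, a < b < n -> nonmatch pos a b = (a < nth 0 s (n - b.+1)).

(** The part of index [n - b.+1] is at most [k - (n - b.+1)], which is below [b] since [k < n - 2].
    Past the last part, the default 0 is below [b]. *)
Lemma partition_code k n s : k < n - 2 -> is_partition k s ->
  forall b, 0 < b -> nth 0 s (n - b.+1) < b.
Proof.
move=> kn ps b b0; have [si|?] := ltnP (n - b.+1) (size s).
  have := nth_partition ps si; lia.
by rewrite nth_default.
Qed.

Lemma partition_code_mono k n s : is_partition k s ->
  forall b b', b <= b' -> nth 0 s (n - b.+1) <= nth 0 s (n - b'.+1).
Proof.
case/and3P=> ss _ _ b b' bb'.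
have [si|?] := ltnP (n - b.+1) (size s); last by rewrite nth_default.
apply: (sorted_leq_nth _ _ 0 ss); rewrite ?inE; try lia.
  by move=> y x w /= xy yw; apply: leq_trans yw xy.
by move=> x /=.
Qed.

Section Shapes.

Variables (n k : nat) (n_gt0 : 0 < n).
Hypothesis lt_k_n2 : k < n - 2.
Implicit Type C : 'S_n.

Lemma shape_NMmu C s : C \in ncycles n -> is_partition k s ->
  has_shape (pos n_gt0 C) n s -> NMmu n_gt0 C = k.
Proof.
move=> Cn ps sh; have /and3P[_ _ /eqP<-] := ps; rewrite NMmuE //.
have sn : size s <= n by have := size_partition ps; lia.
rewrite (sumn_ord sn) -sum_rev; apply: eq_bigr => b _.
(* For [b = 0] the index [n - 1] is past the last part, so the value is the default 0. *)
have code : nth 0 s (n - b.+1) <= b.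
  have [->|/(partition_code lt_k_n2 ps)] := posnP b; last exact: ltnW.
  by rewrite nth_default //; have := size_partition ps; lia.
rewrite -[RHS](sum_ltn (leq_trans code (ltnW (ltn_ord b)))).
apply: eq_bigr => a _; congr nat_of_bool.
have [ab|ba] := ltnP a b; first by apply: sh; rewrite ab /=.
by rewrite ltnNge (leq_trans code ba); apply/negP=> /nonmatch_gap; lia.
Qed.

Lemma ncycle_of_partition s : is_partition k s ->
  exists2 C, C \in ncycles n & has_shape (pos n_gt0 C) n s.
Proof.
move=> ps; pose c b := nth 0 s (n - b.+1).
have c_lt b : 0 < b < n -> c b < b.
  by case/andP=> b0 _; apply: partition_code ps _ b0.
have [C Cn eC] := entries_surj n_gt0 (perm_arrangement c n) (nth0_arrangement c n).
exists C => //; apply: (insertion_nonmatch (pos_inj Cn) c_lt).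
  by have := arrangement_insertion c_lt; rewrite -eC.
by move=> b b' /andP[_ bb'] _; apply: partition_code_mono ps _ _ bb'.
Qed.

Lemma has_shape_inj C C' s : C \in ncycles n -> C' \in ncycles n ->
    is_partition k s ->
    has_shape (pos n_gt0 C) n s -> has_shape (pos n_gt0 C') n s ->
  C = C'.
Proof.
move=> Cn Cn' ps sh sh'; pose c b := nth 0 s (n - b.+1).
have c_lt b : 0 < b < n -> c b < b.
  by case/andP=> b0 _; apply: partition_code ps _ b0.
apply: (pos_order_inj (n_gt0 := n_gt0)) => //.
apply: (@insertion_order _ _ c) => //; try exact: pos_inj.
- exact: nonmatch_insertion (pos_inj Cn) c_lt (pos0 _ _) sh.
- exact: nonmatch_insertion (pos_inj Cn') c_lt (pos0 _ _) sh'.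
Qed.

(** A shape only tests [a < b], but [partition_code] puts both parts in this range; testing [a] at
    each of them gives equality. *)
Lemma shape_inj f s s' : is_partition k s -> is_partition k s' ->
  has_shape f n s -> has_shape f n s' -> s = s'.
Proof.
move=> ps ps' sh sh'; apply: (partition_eq ps ps') => i ik.
have lt := partition_code lt_k_n2 ps (ltac:(lia) : 0 < n - i.+1).
have lt' := partition_code lt_k_n2 ps' (ltac:(lia) : 0 < n - i.+1).
have e : n - (n - i.+1).+1 = i by lia.
have h a : a < n - i.+1 -> (a < nth 0 s i) = (a < nth 0 s' i).
  move=> ai; have := sh a (n - i.+1) ltac:(lia).
  by rewrite sh' ?e //; lia.
rewrite !e in lt lt'.
have := h (nth 0 s i) lt; have := h (nth 0 s' i) lt'; lia.
Qed.

(** The alternative yields at least [n - 2 > k] distinct non-matches. *)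
Lemma few_nonmatches_young C : C \in ncycles n -> NMmu n_gt0 C = k ->
  young (pos n_gt0 C) 0 n.-1.
Proof.
move=> Cn eNM.
have [//|[l [ul sl] lP]] := young_or_many (pos_inj Cn) (ltac:(lia) : 0 <= n.-1 < n).
suff: size l <= NMmu n_gt0 C by lia.
rewrite /NMmu cardE -(size_map (fun ab => (val ab.1, val ab.2))).
apply: uniq_leq_size => // -[a b] /lP[_ bn nm].
have an := nonmatch_gap nm.
have an' : a < n by lia.
have bn' : b < n by lia.
apply/mapP; exists (Ordinal an', Ordinal bn') => //.
by rewrite mem_enum inE nonmu_matchE.
Qed.

Lemma partition_of_ncycle C : C \in ncycles n -> NMmu n_gt0 C = k ->
  exists2 s, is_partition k s & has_shape (pos n_gt0 C) n s.
Proof.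
move=> Cn eNM; have y := few_nonmatches_young Cn eNM.
(* The height of the column of [b = n - 1 - i], nonincreasing in [i] by the Young property. For
   [i >= n] truncated subtraction gives [b = 0], an empty column. *)
pose f i := \sum_(a < n) nonmatch (pos n_gt0 C) a (n - i.+1).
have [i|i ni|s [ss s0 sn sf]] := @seq_of_nonincreasing f n.
- apply: leq_sum => a _.
  have : nonmatch (pos n_gt0 C) a (n - i.+2) -> nonmatch (pos n_gt0 C) a (n - i.+1).
    by apply: y; lia.
  by case: nonmatch => // ->.
- rewrite /f big1 // => a _; have -> : n - i.+1 = 0 by lia.
  by apply/eqP; rewrite eqb0; apply/negP => /nonmatch_gap.
exists s.
  apply/and3P; split=> //; rewrite -eNM NMmuE // (sumn_ord sn).
  under eq_bigr => i _ do rewrite sf.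
  rewrite -sum_rev; apply/eqP/eq_bigr => b _; apply: eq_bigr => a _.
  by congr (nat_of_bool (nonmatch _ _ _)); have := ltn_ord b; lia.
move=> a b /andP[ab bn]; rewrite sf /f.
have -> : n - (n - b.+1).+1 = b by lia.
apply: (sum_initial (p := nonmatch (pos n_gt0 C) ^~ b)); last by lia.
by move=> a1 a2 a12; apply: y; lia.
Qed.

End Shapes.

(** * Counting cycles by partitions *)

(** Choosing a related [y] for each [x] gives a map injective on [A]. Applied in both directions,
    this counts with the [Prop]-valued [has_shape] without an explicit bijection. *)
Lemma card_rel_leq (T U : finType) (A : {set T}) (B : {set U}) (R : T -> U -> Prop) :
    (forall x, x \in A -> exists2 y, y \in B & R x y) ->
    (forall x x' y, x \in A -> x' \in A -> y \in B -> R x y -> R x' y -> x = x') ->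
  #|A| <= #|B|.
Proof.
(* A nonempty [A] provides the value [y0] of the chosen map outside [A]. *)
move=> AB inj; have [->|[x0 Ax0]] := set_0Vmem A; first by rewrite cards0.
have [y0 _ _] := AB x0 Ax0.
have /fin_all_exists[f fP] (x : T) :
    exists y, x \in A -> y \in B /\ R x y.
  have [/AB[y yB xy]|_] := boolP (x \in A); [by exists y | by exists y0].
rewrite -(card_in_imset (f := f)).
  by apply/subset_leq_card/subsetP=> _ /imsetP[x /fP[fB _] ->].
move=> x x' Ax Ax' e; have [[fB xR] [_ xR']] := (fP x Ax, fP x' Ax').
by apply: inj xR _ => //; rewrite e.
Qed.

Import GRing.Theory.
Local Open Scope ring_scope.

Theorem theorem11 (n k : nat) (n_gt0 : (0 < n)%N) (lt_k_n2 : (k < n - 2)%N) :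
  (NMmu_poly n_gt0)`_k = (num_partitions k)%:R.
Proof.
rewrite /NMmu_poly coef_sum.
pose A := [set C in ncycles n | NMmu n_gt0 C == k].
pose B := [set p : k.-bseq 'I_k.+1 | is_partition k (map val p)].
pose R (C : 'S_n) (p : k.-bseq 'I_k.+1) := has_shape (pos n_gt0 C) n (map val p).
(* The coefficient of a sum of monomials counts those of exponent [k]. *)
transitivity (#|A|%:R : int).
  under eq_bigr => C _ do rewrite coefXn eq_sym.
  rewrite -natr_sum -sum1_card; congr (_%:R).
  rewrite [RHS]big_mkcond [LHS]big_mkcond; apply: eq_bigr => C _.
  have -> : (C \in A) = (C \in ncycles n) && (NMmu n_gt0 C == k) by rewrite inE.
  by case: (C \in ncycles n); case: eqP.
congr (_%:R); apply/eqP; rewrite eqn_leq; apply/andP; split.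
  apply: (@card_rel_leq _ _ A B R) => [C|C C' p].
    rewrite inE => /andP[Cn /eqP eNM].
    have [s ps sh] := partition_of_ncycle lt_k_n2 Cn eNM.
    have [p ep] := partition_bseq ps.
    by exists p; rewrite ?inE /R ep.
  rewrite [C \in A]inE [C' \in A]inE [p \in B]inE => /andP[Cn _] /andP[Cn' _] pp.
  exact: has_shape_inj pp.
apply: (@card_rel_leq _ _ B A (fun p C => R C p)) => [p|p p' C].
  rewrite inE => pp; have [C Cn sh] := ncycle_of_partition n_gt0 lt_k_n2 pp.
  by exists C; rewrite // inE Cn (shape_NMmu _ Cn pp) /=.
rewrite !inE => pp pp' _ sh sh'; apply/val_inj/(inj_map val_inj).
exact: shape_inj pp pp' sh sh'.
Qed.
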